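(* Let $G$ be a connected compact Hausdorff abelian group with Haar probability measure $\mu$, let $\alpha$ be a real number, and let $A,B$ be $K$-analytic subsets of $G$ satisfying $0<\mu(A+B)\leq \alpha\,\mu(A)$. Then for every positive integer $n$ such that $\alpha^n<1/\mu(A)$, we have $\mu(nB)\leq (\alpha^n-1)\,\mu(A)$.
   Context: A subset $S$ of a topological space $Y$ is a $K_{\sigma\delta}$ set if $S=\bigcap_{i\in\mathbb{N}}\bigcup_{j\in\mathbb{N}}K_{i,j}$ for compact sets $K_{i,j}\subset Y$. A subset $A$ of a Hausdorff space $X$ is $K$-analytic if there is a $K_{\sigma\delta}$ set $S$ in some compact Hausdorff space and a continuous map $f:S\to X$ with $A=f(S)$. $nB=\{b_1+\dots+b_n:b_i\in B\}$. *)

(* Defs.v *)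
From HB Require Import structures.
From mathcomp Require Import all_boot all_order all_algebra.
From mathcomp Require Import all_classical all_reals all_analysis.
Set Implicit Arguments. Unset Strict Implicit. Unset Printing Implicit Defensive.
Import Order.TTheory GRing.Theory Num.Theory numFieldTopology.Exports.
Local Open Scope classical_set_scope.
Local Open Scope ring_scope.

Definition borel_set (T : topologicalType) (A : set T) : Prop :=
  <<s [set U : set T | open U] >> A.

Definition haar_probability (R : realType) (G : topologicalZmodType)
    (mu : set G -> R) : Prop :=
  [/\ (forall A, borel_set A -> 0 <= mu A),
      mu set0 = 0,
      mu setT = 1 &
      (forall (x : G) A, borel_set A -> mu [set x + a | a in A] = mu A)] /\
  [/\
      (forall F : nat -> set G, (forall k, borel_set (F k)) ->
          trivIset setT F ->
          ((fun N : nat => \sum_(k < N) mu (F k)) : R^nat) @ \oo --> mu (\bigcup_k F k)),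
      (forall A, borel_set A ->
          mu A = inf [set mu U | U in [set U : set G | open U /\ A `<=` U]]) &
      (forall U, open U ->
          mu U = sup [set mu K | K in [set K : set G | compact K /\ K `<=` U]])].

(** Outer measure induced by mu (via open supersets). For sets measurable for
    the completion of the Radon measure mu (e.g. K-analytic sets) this is the
    value of the completed measure. *)
Definition outer_mu (R : realType) (G : topologicalType) (mu : set G -> R)
    (A : set G) : R :=
  inf [set mu U | U in [set U : set G | open U /\ A `<=` U]].

Definition K_sigma_delta (Y : topologicalType) (S : set Y) : Prop :=
  exists K : nat -> nat -> set Y,
    (forall i j, compact (K i j)) /\ S = \bigcap_i \bigcup_j K i j.

Definition K_analytic (X : topologicalType) (A : set X) : Prop :=
  exists (Y : topologicalType) (S : set Y) (f : Y -> X),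
    [/\ hausdorff_space Y, compact [set: Y], K_sigma_delta S,
        {within S, continuous f} & A = f @` S].

Definition sumset (G : zmodType) (A B : set G) : set G :=
  [set a + b | a in A & b in B].

Definition nfold_sumset (G : zmodType) (n : nat) (B : set G) : set G :=
  [set x | exists b : 'I_n -> G, (forall i, B (b i)) /\ x = \sum_(i < n) b i].

(* Main.v *)
(** For compact A and B with mu(A + B) < alpha mu(A), Petridis' argument gives a
    compact X in A of positive measure with mu(X + nB) <= alpha^n mu(X) < 1. In a
    connected group Kneser's inequality mu(X + C) >= min(1, mu(X) + mu(C)) holds;
    with C = nB it yields mu(nB) <= (alpha^n - 1) mu(X). K-analytic sets are
    reduced to compact ones by Choquet's capacitability argument, applied to the
    capacities E |-> mu^*(nE).

    Kneser's inequality: the excess A |-> mu(A + B) - mu(A) is submodular, and by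
    connectedness mu(A `&` (x + A)) takes every value in ]mu(A)^2, mu(A)]. So the
    infimum of the excess over the sets of measure t is locally concave in t, hence
    at least the minimum of its values near t = 0 and t = 1 - mu(B), both close to
    mu(B). *)

Require Import Defs.
From HB Require Import structures.
From mathcomp Require Import all_boot all_order all_algebra.
From mathcomp Require Import all_classical all_reals all_analysis.
From mathcomp Require Import lra ring.
Set Implicit Arguments. Unset Strict Implicit. Unset Printing Implicit Defensive.
Import Order.TTheory GRing.Theory Num.Theory numFieldNormedType.Exports.
Local Open Scope classical_set_scope.
Local Open Scope ring_scope.

(** * Haar measure and its outer measure *)

Section Borel.
Variable T : topologicalType.
Implicit Types (A B : set T) (F : nat -> set T).

Lemma borel0 : borel_set (@set0 T).
Proof. by have [] := @smallest_sigma_algebra T setT (fun U : set T => open U). Qed.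

Lemma borelC A : borel_set A -> borel_set (~` A).
Proof.
by rewrite -setTD; have [_ + _] := @smallest_sigma_algebra T setT (fun U : set T => open U); apply.
Qed.

Lemma borel_bigcup F : (forall k, borel_set (F k)) -> borel_set (\bigcup_k F k).
Proof.
by have [_ _] := @smallest_sigma_algebra T setT (fun U : set T => open U); apply.
Qed.

Lemma borel_bigcap F : (forall k, borel_set (F k)) -> borel_set (\bigcap_k F k).
Proof.
move=> bF; rewrite -[X in borel_set X]setCK setC_bigcap; apply: borelC.
by apply: borel_bigcup => k; apply: borelC.
Qed.

Lemma borelU A B : borel_set A -> borel_set B -> borel_set (A `|` B).
Proof.
move=> bA bB; rewrite -bigcup2E; apply: borel_bigcup => -[|[|k]] //=.
exact: borel0.
Qed.

Lemma borelI A B : borel_set A -> borel_set B -> borel_set (A `&` B).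
Proof.
move=> bA bB; rewrite -[X in borel_set X]setCK setCI; apply: borelC.
by apply: borelU; apply: borelC.
Qed.

Lemma borelD A B : borel_set A -> borel_set B -> borel_set (A `\` B).
Proof. by move=> bA bB; rewrite setDE; apply: borelI => //; apply: borelC. Qed.

Lemma borel_open A : open A -> borel_set A.
Proof. by move=> oA; apply: sub_sigma_algebra. Qed.

Lemma borelT : borel_set (@setT T).
Proof. exact: borel_open openT. Qed.

Lemma borel_closed A : closed A -> borel_set A.
Proof.
by move=> cA; rewrite -[A]setCK; apply: borelC; apply: borel_open; rewrite openC.
Qed.

Lemma borel_compact A : hausdorff_space T -> compact A -> borel_set A.
Proof. by move=> hT cA; apply: borel_closed; apply: compact_closed. Qed.

End Borel.

Section HaarProbability.
Variables (R : realType) (G : topologicalZmodType) (mu : set G -> R).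
Hypothesis hmu : haar_probability mu.
Implicit Types (A B D E U : set G) (v : R).

Lemma mu_ge0 A : borel_set A -> 0 <= mu A. Proof. by case: hmu => -[+ _ _ _] _; apply. Qed.

Lemma mu0 : mu set0 = 0. Proof. by case: hmu => -[]. Qed.

Lemma muT : mu setT = 1. Proof. by case: hmu => -[]. Qed.

Lemma mu_cvg (F : nat -> set G) : (forall k, borel_set (F k)) -> trivIset setT F ->
  ((fun N : nat => \sum_(k < N) mu (F k)) : R^nat) @ \oo --> mu (\bigcup_k F k).
Proof. by case: hmu => _ [+ _ _]; apply. Qed.

Lemma muU_disj A B : borel_set A -> borel_set B -> A `&` B = set0 ->
  mu (A `|` B) = mu A + mu B.
Proof.
move=> bA bB AB; rewrite -bigcup2E.
have /mu_cvg/(_ _) h : forall k, borel_set (bigcup2 A B k).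
  by move=> [|[|k]] //; apply: borel0.
rewrite -trivIset_bigcup2 in h; have {}h := h AB.
suff: ((fun N : nat => \sum_(k < N) mu (bigcup2 A B k)) : R^nat) @ \oo --> mu A + mu B.
  by move=> h'; apply: (cvg_unique _ h h').
rewrite -(cvg_shiftn 2); apply: cvg_near_cst; near=> N.
rewrite /= addn2 !big_ord_recl big1 ?addr0 // => i _; exact: mu0.
Unshelve. all: by end_near. Qed.

Lemma muD A B : borel_set A -> borel_set B -> mu A = mu (A `&` B) + mu (A `\` B).
Proof.
move=> bA bB; rewrite -[in LHS](setUIDK A B); apply: muU_disj.
- exact: borelI.
- exact: borelD.
- by apply/seteqP; split=> x //= [[_ ?] []].
Qed.

Lemma mu_mono A B : borel_set A -> borel_set B -> A `<=` B -> mu A <= mu B.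
Proof.
move=> bA bB AB; rewrite (muD bB bA) setIC (setIidl AB) lerDl.
by apply: mu_ge0; apply: borelD.
Qed.

Lemma mu_le1 A : borel_set A -> mu A <= 1.
Proof. by move=> bA; rewrite -muT; apply: mu_mono => //; apply: borelT. Qed.

Lemma mu_modular A B : borel_set A -> borel_set B ->
  mu (A `|` B) + mu (A `&` B) = mu A + mu B.
Proof.
move=> bA bB; have bAB := borelU bA bB.
rewrite (muD bAB bA) (setIidr (@subsetUl _ A B)) setDUl setDv set0U.
by rewrite (muD bB bA) (setIC B) -addrA; congr (_ + _); rewrite addrC.
Qed.

(** Countable additivity applies to the successive differences [seqD F], whose partial sums
    telescope to a single [mu (F k)]. *)
Lemma mu_bigcup_le (F : nat -> set G) v : (forall k, borel_set (F k)) ->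
  nondecreasing_seq F -> (forall k, mu (F k) <= v) -> mu (\bigcup_k F k) <= v.
Proof.
move=> bF ndF Fv; rewrite -eq_bigcup_seqD.
have bD k : borel_set (seqD F k) by case: k => [|k]; [exact: bF|exact: borelD].
have /= cF := mu_cvg bD (trivIset_seqD ndF).
apply: (cvgr_to_le cF); near=> N.
have /prednK <- : (0 < N)%N by near: N; exact: nbhs_infty_gt.
have -> : \sum_(k < N.-1.+1) mu (seqD F k) = mu (F N.-1).
  elim: (N.-1) => [|n IH]; first by rewrite big_ord_recl big_ord0 addr0.
  rewrite big_ord_recr/= IH.
  rewrite -muU_disj //; last 2 first.
  - exact: (bD n.+1).
  - by rewrite setDIK.
  by rewrite setDUK // -subsetEset; exact: ndF.
exact: Fv.
Unshelve. all: by end_near. Qed.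

Lemma mu_translate (x : G) A : borel_set A -> mu [set x + a | a in A] = mu A.
Proof. by case: hmu => -[_ _ _ h] _; exact: h. Qed.

Lemma mu_outer A : borel_set A -> outer_mu mu A = mu A.
Proof. by case: hmu => _ [_ h _] bA; rewrite (h _ bA). Qed.

Lemma outer_has_inf A :
  has_inf [set mu U | U in [set U : set G | open U /\ A `<=` U]].
Proof.
split; first by exists (mu setT), setT => //; split=> //; exact: openT.
by exists 0 => _ [U [oU _] <-]; apply: mu_ge0; apply: borel_open.
Qed.

Lemma outer_le_open A U : open U -> A `<=` U -> outer_mu mu A <= mu U.
Proof. by move=> oU AU; apply: ge_inf; [exact: (outer_has_inf A).2|exists U]. Qed.

Lemma le_outer A v : (forall U, open U -> A `<=` U -> v <= mu U) -> v <= outer_mu mu A.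
Proof.
move=> h; apply: lb_le_inf; first exact: (outer_has_inf A).1.
by move=> _ [U [oU AU] <-]; exact: h.
Qed.

Lemma outer_mono A B : A `<=` B -> outer_mu mu A <= outer_mu mu B.
Proof.
by move=> AB; apply: le_outer => U oU BU; apply: outer_le_open => // x /AB /BU.
Qed.

Lemma outer_le A B : borel_set B -> A `<=` B -> outer_mu mu A <= mu B.
Proof. by move=> bB AB; rewrite -mu_outer //; exact: outer_mono. Qed.

Lemma outer_ge0 A : 0 <= outer_mu mu A.
Proof. by apply: le_outer => U oU _; apply: mu_ge0; apply: borel_open. Qed.

Lemma outer_lt_open A v : outer_mu mu A < v -> exists U, [/\ open U, A `<=` U & mu U < v].
Proof.
move=> Av; have e0 : 0 < v - outer_mu mu A by rewrite subr_gt0.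
have [_ [U [oU AU] <-]] := inf_adherent e0 (outer_has_inf A).
by rewrite -/(outer_mu mu A) addrC subrK => Uv; exists U.
Qed.

Lemma borel_hull A : exists H, [/\ borel_set H, A `<=` H & mu H <= outer_mu mu A].
Proof.
have /choice[U hU] k : exists U, [/\ open U, A `<=` U & mu U < outer_mu mu A + k.+1%:R^-1].
  by apply: outer_lt_open; rewrite ltrDl invr_gt0 ltr0n.
have bU k : borel_set (U k) by case: (hU k) => ? _ _; apply: borel_open.
exists (\bigcap_k U k); split; first exact: borel_bigcap.
  by move=> x Ax k _; case: (hU k) => _ + _; apply.
apply/ler_addgt0Pr => e e0.
have [k ke] : exists k, k.+1%:R^-1 < e.
  by have [k] := ltr_add_invr e0; rewrite add0r; exists k.
apply: (@le_trans _ _ (mu (U k))).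
  by apply: mu_mono => //; [exact: borel_bigcap|exact: bigcap_inf].
by case: (hU k) => _ _ /ltW /le_trans; apply; rewrite lerD2l ltW.
Qed.

(** Continuity from below for arbitrary sets, the property of [mu^*] on which the capacity argument
    rests. Borel hulls reduce it to [mu_bigcup_le]. *)
Lemma outer_bigcup_le (F : nat -> set G) v : nondecreasing_seq F ->
  (forall k, outer_mu mu (F k) <= v) -> outer_mu mu (\bigcup_k F k) <= v.
Proof.
move=> ndF Fv; have /choice[H hH] k := borel_hull (F k).
have bH k : borel_set (H k) by case: (hH k).
(* The hulls [H k] need not increase; their tail intersections do, and these still contain [F k]
   because [F] increases. *)
pose D k := \bigcap_i H (k + i)%N.
have bD k : borel_set (D k) by apply: borel_bigcap.
apply: (@le_trans _ _ (mu (\bigcup_k D k))).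
  apply: outer_le; first exact: borel_bigcup.
  move=> x [k _ Fx]; exists k => // i _; case: (hH (k + i)%N) => _ + _; apply.
  by have := ndF k (k + i)%N (leq_addr _ _); rewrite subsetEset; apply.
apply: mu_bigcup_le => //.
  by move=> i j ij; rewrite subsetEset => x Dx k _; have := Dx (j - i + k)%N I; rewrite addnA subnKC.
move=> k; apply: le_trans (Fv k); case: (hH k) => _ _; apply: le_trans.
by apply: mu_mono => // x /(_ 0%N I); rewrite addn0.
Qed.

End HaarProbability.
Arguments mu_translate {R G mu} hmu x {A}.

(** * Sumsets *)

Section SumsetAlgebra.
Variable G : zmodType.
Implicit Types (A B C : set G) (n : nat).

Lemma sumsetS A A' B B' : A `<=` A' -> B `<=` B' -> sumset A B `<=` sumset A' B'.
Proof. by move=> AA BB _ [a /AA ? [b /BB ? <-]]; exists a => //; exists b. Qed.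

Lemma sumsetA A B C : sumset A (sumset B C) = sumset (sumset A B) C.
Proof.
apply/seteqP; split.
  by move=> _ [a ? [_ [b ? [c ? <-]] <-]]; exists (a + b); [exists a => //; exists b|exists c => //; rewrite addrA].
by move=> _ [_ [a ? [b ? <-]] [c ? <-]]; exists a => //; exists (b + c); [exists b => //; exists c|rewrite addrA].
Qed.

Lemma sumsetC A B : sumset A B = sumset B A.
Proof.
by apply/seteqP; split=> _ [a ? [b ? <-]]; exists b => //; exists a => //; rewrite addrC.
Qed.

Lemma sumset0l B : sumset [set 0] B = B.
Proof.
apply/seteqP; split=> [_ [_ -> [b ? <-]]|b Bb]; first by rewrite add0r.
by exists 0 => //; exists b => //; rewrite add0r.
Qed.

Lemma translateE x A : [set x + a | a in A] = sumset A [set x].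
Proof.
apply/seteqP; split=> [_ [a ? <-]|_ [a ? [_ -> <-]]].
  by exists a => //; exists x => //; rewrite addrC.
by exists a => //; rewrite addrC.
Qed.

Lemma sumsetUl A A' B : sumset (A `|` A') B = sumset A B `|` sumset A' B.
Proof.
apply/seteqP; split=> [_ [a [] ? [b ? <-]]|_ [] [a ? [b ? <-]]].
- by left; exists a => //; exists b.
- by right; exists a => //; exists b.
- by exists a; [left|exists b].
- by exists a; [right|exists b].
Qed.

Lemma sumsetUr A B B' : sumset A (B `|` B') = sumset A B `|` sumset A B'.
Proof. by rewrite !(sumsetC A) sumsetUl. Qed.

Lemma nfold_sumset0 B : nfold_sumset 0 B = [set 0].
Proof.
apply/seteqP; split=> [x [b [_ ->]]|_ ->]; first by rewrite big_ord0.
by exists (fun=> 0); split; [case|rewrite big_ord0].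
Qed.

Lemma nfold_sumsetS n B : nfold_sumset n.+1 B = sumset (nfold_sumset n B) B.
Proof.
apply/seteqP; split=> [_ [b [hb ->]]|_ [_ [b [hb ->]] [c Bc <-]]].
  rewrite big_ord_recr /=; exists (\sum_(i < n) b (widen_ord (leqnSn n) i)).
    by exists (fun i => b (widen_ord (leqnSn n) i)).
  by exists (b ord_max).
exists (fun i => if unlift ord_max i is Some j then b j else c); split.
  by move=> i; case: unliftP.
rewrite big_ord_recr /= unlift_none; congr (_ + _); apply: eq_bigr => i _.
have -> : widen_ord (leqnSn n) i = lift ord_max i.
  by apply: val_inj; rewrite /= /bump leqNgt ltn_ord.
by rewrite liftK.
Qed.

Lemma nfold_sumset1 B : nfold_sumset 1 B = B.
Proof. by rewrite nfold_sumsetS nfold_sumset0 sumset0l. Qed.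

Lemma subset_nfold_sumset n A B : A `<=` B -> nfold_sumset n A `<=` nfold_sumset n B.
Proof. by move=> AB x [b [hb ->]]; exists b; split=> // i; apply: AB. Qed.

Lemma nfold_bigcup n (F : nat -> set G) : nondecreasing_seq F ->
  nfold_sumset n (\bigcup_k F k) `<=` \bigcup_k nfold_sumset n (F k).
Proof.
move=> ndF _ [b [hb ->]].
have /choice[k hk] i : exists k, F k (b i) by have [k _ ?] := hb i; exists k.
exists (\max_i k i)%N => //; exists b; split=> // i.
by have := ndF (k i) (\max_i k i)%N (leq_bigmax i); rewrite subsetEset; apply.
Qed.

Lemma nfold_sumsetD n A B :
  nfold_sumset n (sumset A B) `<=` sumset (nfold_sumset n A) (nfold_sumset n B).
Proof.
elim: n => [|n IH]; first by rewrite !nfold_sumset0 sumset0l.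
rewrite !nfold_sumsetS => _ [x /IH [a ha [b hb <-]] [_ [c hc [d hd <-]] <-]].
by exists (a + c); [exists a => //; exists c|exists (b + d); [exists b => //; exists d|rewrite addrACA]].
Qed.

End SumsetAlgebra.

(** * Topology of sumsets *)

Section SumsetTopology.
Variable G : topologicalZmodType.
Implicit Types (A B K U W : set G) (n : nat).

Lemma addl_continuous (a : G) : continuous (fun y : G => a + y).
Proof.
move=> y; apply: (@continuous_comp _ (G * G)%type _ (fun y => (a, y)) (fun z => z.1 + z.2)).
  by apply: cvg_pair => /=; [exact: cvg_cst|exact: cvg_id].
exact: add_continuous.
Qed.

Lemma open_translate (a : G) U : open U -> open [set y | U (a + y)].
Proof. by move=> oU; have /continuousP := @addl_continuous a; apply. Qed.

Lemma open_sumset A U : open U -> open (sumset A U).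
Proof.
move=> oU; have -> : sumset A U = \bigcup_(a in A) [set y | U (- a + y)].
  apply/seteqP; split=> [_ [a ? [u ? <-]]|y [a ? /= ?]].
    by exists a => //=; rewrite addKr.
  by exists a => //; exists (- a + y) => //; rewrite addNKr.
by apply: bigcup_open => a _; exact: open_translate.
Qed.

Lemma compact_sumset A B : compact A -> compact B -> compact (sumset A B).
Proof.
move=> cA cB; have -> : sumset A B = (fun z : G * G => z.1 + z.2) @` (A `*` B).
  by apply/seteqP; split=> [_ [a ? [b ? <-]]|_ [[a b] [/= ? ?] <-]]; [exists (a, b)|exists a => //; exists b].
apply: continuous_compact (compact_setX cA cB).
by apply: continuous_subspaceT; exact: add_continuous.
Qed.

Lemma compact_opp A : compact A -> compact [set - a | a in A].
Proof.
by apply: continuous_compact; apply: continuous_subspaceT; exact: opp_continuous.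
Qed.

Lemma compact_nfold n A : compact A -> compact (nfold_sumset n A).
Proof.
move=> cA; elim: n => [|n IH]; first by rewrite nfold_sumset0; exact: compact_set1.
by rewrite nfold_sumsetS; exact: compact_sumset.
Qed.

(** Addition is continuous at each [(x, 0)] with [x] in [K]; compactness makes the neighbourhood of
    0 uniform in [x]. *)
Lemma compact_tube K U : compact K -> open U -> K `<=` U ->
  exists W, [/\ open W, W 0 & sumset K W `<=` U].
Proof.
move=> /compact_near_coveringP cK oU KU.
have : \forall w \near (0 : G), K `<=` (fun x => U (x + w)).
  apply: (cK G (nbhs 0) (fun w x => U (x + w))) => x Kx.
  have := @add_continuous G (x, 0) U; apply; rewrite /= addr0.
  by apply: open_nbhs_nbhs; split=> //; exact: KU.
move=> /nbhs_interior W0.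
exists [set w | K `<=` (fun x => U (x + w))]^°; split; first exact: open_interior.
- exact: nbhs_singleton.
- by move=> _ [x Kx [w /interior_subset Ww <-]]; exact: Ww.
Qed.

Lemma half_nbhs W : open W -> W 0 -> exists V, [/\ open V, V 0 & sumset V V `<=` W].
Proof.
move=> oW W0; have : nbhs ((0, 0) : G * G) [set z | W (z.1 + z.2)].
  by apply: (@add_continuous G (0, 0)); rewrite /= addr0; exact: open_nbhs_nbhs.
move=> [[P Q] /= [/nbhs_interior P0 /nbhs_interior Q0] PQ].
exists (P^° `&` Q^°); split.
- by apply: openI; exact: open_interior.
- by split; exact: nbhs_singleton.
- move=> _ [a [/interior_subset ? _] [b [_ /interior_subset ?] <-]].
  exact: (PQ (a, b)).
Qed.

Lemma nfold_nbhs n W : open W -> W 0 ->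
  exists V, [/\ open V, V 0 & nfold_sumset n V `<=` W].
Proof.
elim: n W => [|n IH] W oW W0.
  by exists setT; split=> //; [exact: openT|rewrite nfold_sumset0 => _ ->].
have [V [oV V0 VW]] := half_nbhs oW W0; have [V' [oV' V'0 V'V]] := IH _ oV V0.
exists (V `&` V'); split=> //; first exact: openI.
rewrite nfold_sumsetS; apply: subset_trans VW; apply: sumsetS => //.
by apply: subset_trans V'V; exact: subset_nfold_sumset.
Qed.

(** Thicken [K] by a neighbourhood of 0 whose [n]-fold sumset is small. This makes [E |-> mu^*(nE)]
    continuous from above at compact sets. *)
Lemma nfold_tube n K U : compact K -> open U -> nfold_sumset n K `<=` U ->
  exists V, [/\ open V, K `<=` V & nfold_sumset n V `<=` U].
Proof.
move=> cK oU KU; have [W [oW W0 KWU]] := compact_tube (compact_nfold cK) oU KU.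
have [V [oV V0 VW]] := nfold_nbhs n oW W0.
exists (sumset K V); split; first exact: open_sumset.
- by move=> x Kx; exists x => //; exists 0 => //; rewrite addr0.
- by apply: subset_trans KWU; apply: subset_trans (sumsetS _ VW); [exact: nfold_sumsetD|].
Qed.

Lemma compact_net K W : compact K -> open W -> W 0 ->
  exists s : seq G, [set` s] `<=` K /\ K `<=` sumset [set` s] W.
Proof.
move=> /compact_near_coveringP cK oW W0.
(* The filter of finite subsets of [K] directed by inclusion: near-covering compactness along it
   produces a finite net. *)
pose F (P : set (seq G)) := exists s : seq G, [set` s] `<=` K /\
  forall s' : seq G, {subset s <= s'} -> [set` s'] `<=` K -> P s'.
have FF : Filter F; first split.
- by exists [::]; split=> // x.
- move=> P Q [s [sK sP]] [t [tK tQ]]; exists (s ++ t); split.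
    by move=> x /=; rewrite mem_cat => /orP [/sK|/tK].
  move=> u su uK; split; [apply: sP|apply: tQ] => // x xs; apply: su.
    by rewrite mem_cat xs.
  by rewrite mem_cat xs orbT.
- by move=> P Q PQ [s [sK sP]]; exists s; split=> // s' ss' s'K; apply: PQ; exact: sP.
have : F (fun s => K `<=` sumset [set` s] W).
  apply: (cK _ F (fun s => sumset [set` (s : seq G)] W)) => x Kx.
  exists ([set y | W (- x + y)], [set s : seq G | x \in s]) => /=.
    split; last first.
      exists [:: x]; split=> [y|s xs _]; first by rewrite /= inE => /eqP ->.
      by apply: xs; rewrite inE.
    apply: open_nbhs_nbhs; split; first exact: open_translate.
    by rewrite /= addNr.
  by move=> [y s] /= [Wy xs]; exists x => //; exists (- x + y) => //; rewrite addNKr.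
by move=> [s [sK h]]; exists s; split=> //; exact: h.
Qed.

End SumsetTopology.

(** * Averaging over translates *)

Section Averaging.
Variables (R : realType) (G : topologicalZmodType) (mu : set G -> R).
Hypotheses (hT : hausdorff_space G) (cT : compact [set: G]).
Hypothesis hmu : haar_probability mu.
Implicit Types (A B D E U : set G) (c : R).

Let bK A (cA : compact A) : borel_set A := borel_compact hT cA.

Lemma mu_subadditive A B : borel_set A -> borel_set B -> mu (A `|` B) <= mu A + mu B.
Proof.
by move=> bA bB; rewrite -(mu_modular hmu bA bB) lerDl; apply: (mu_ge0 hmu); exact: borelI.
Qed.

Lemma mu_setD A B : borel_set A -> borel_set B -> mu (A `\` B) = mu (A `|` B) - mu B.
Proof.
move=> bA bB; have := mu_modular hmu bA bB; rewrite (muD hmu bA bB); lra.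
Qed.

Lemma borel_bigsetU (F : nat -> set G) (P : pred nat) n : (forall k, borel_set (F k)) ->
  borel_set (\big[setU/set0]_(i < n | P i) F i).
Proof.
move=> bF; elim/big_ind : _ => //; [exact: borel0|exact: borelU].
Qed.

Lemma mu_bigsetU (F : nat -> set G) (P : pred nat) n : (forall k, borel_set (F k)) ->
  trivIset setT F ->
  mu (\big[setU/set0]_(i < n | P i) F i) = \sum_(i < n | P i) mu (F i).
Proof.
move=> bF tF; elim: n => [|n IH]; first by rewrite !big_ord0 (mu0 hmu).
rewrite !(big_mkcond (fun i => P (nat_of_ord i))) !big_ord_recr -!big_mkcond /=.
case: ifPn => Pn; last by rewrite setU0 addr0.
rewrite (muU_disj hmu) ?IH //; first exact: borel_bigsetU.
by apply: (@trivIset_bigsetUI _ P) => //; exact: sub_trivIset tF.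
Qed.

(** The sum is the integral over [D] of the step function with weight [w i] on [F i]. Induction on
    [s] splits [D] along [F i]: on [D] inside [F i] the remaining weights are bounded by [M - w i],
    outside it by [M]. *)
Lemma sum_mu_setI_le (I : Type) (s : seq I) (w : I -> R) (F : I -> set G) D M :
  (forall i, borel_set (F i)) -> borel_set D ->
  (forall y, D y -> \sum_(i <- s) w i * (y \in F i)%:R <= M) ->
  \sum_(i <- s) w i * mu (D `&` F i) <= M * mu D.
Proof.
move=> bF; elim: s D M => [|i s IH] D M bD hM.
  rewrite big_nil; case: (pselect (D = set0)) => [->|/eqP/set0P [y Dy]].
    by rewrite (mu0 hmu) mulr0.
  by have := hM y Dy; rewrite big_nil => M0; rewrite mulr_ge0 //; exact: (mu_ge0 hmu).
have bDF := borelI bD (bF i); have bDD := borelD bD (bF i).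
have h1 := IH (D `&` F i) (M - w i) bDF _; have h2 := IH (D `\` F i) M bDD _.
rewrite big_cons.
have -> : \sum_(j <- s) w j * mu (D `&` F j) =
  \sum_(j <- s) w j * mu (D `&` F i `&` F j) + \sum_(j <- s) w j * mu ((D `\` F i) `&` F j).
  rewrite -big_split /=; apply: eq_bigr => j _; rewrite -mulrDr; congr (_ * _).
  rewrite (muD hmu (borelI bD (bF j)) (bF i)); congr (mu _ + mu _).
    by rewrite setIAC.
  by rewrite !setDE setIAC.
have {}h1 : \sum_(j <- s) w j * mu (D `&` F i `&` F j) <= (M - w i) * mu (D `&` F i).
  apply: h1 => y [Dy Fy]; have := hM y Dy; rewrite big_cons.
  by rewrite mem_set //= mulr1; lra.
have {}h2 : \sum_(j <- s) w j * mu ((D `\` F i) `&` F j) <= M * mu (D `\` F i).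
  apply: h2 => y [Dy Fy]; have := hM y Dy; rewrite big_cons.
  by rewrite memNset //= mulr0 add0r.
rewrite (muD hmu bD (bF i)); lra.
Qed.

Lemma compact_translate (x : G) A : compact A -> compact [set x + a | a in A].
Proof. by move=> cA; rewrite translateE; apply: compact_sumset => //; exact: compact_set1. Qed.

Arguments compact_translate x {A}.

Lemma open_translate_image (x : G) U : open U -> open [set x + a | a in U].
Proof. by move=> oU; rewrite translateE sumsetC; exact: open_sumset. Qed.

(* Fubini is not available: for non-metrizable G the Borel sets of G * G may not be
   generated by rectangles. Instead G is cut into finitely many Borel pieces
   [E i] contained in [x_i + W]; the sum of the [mu (E i)] with [x_i \in y - A] is
   then at most the measure of [y - A + W], for every y. *)
Lemma average_translate D A c : borel_set D -> compact A ->
  (forall x, c <= mu (D `&` [set x + a | a in A])) ->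
  c <= mu D * mu [set - a | a in A].
Proof.
move=> bD cA hc; have cN := compact_opp cA.
have bN := borel_compact hT cN.
apply/ler_addgt0Pr => e e0.
have [U [oU NU Ue]] : exists U, [/\ open U, [set - a | a in A] `<=` U &
    mu U < mu [set - a | a in A] + e].
  by apply: (outer_lt_open hmu); rewrite (mu_outer hmu bN) ltrDl.
have [W [oW W0 NW]] := compact_tube cN oU NU.
have [s [_ sW]] := compact_net cT oW W0.
pose F i := if (i < size s)%N then [set nth 0 s i + w | w in W] else set0.
have bF i : borel_set (F i).
  rewrite /F; case: ifP => _; last exact: borel0.
  by apply: borel_open; exact: open_translate_image.
pose E := seqDU F.
have bE i : borel_set (E i) by apply: borelD => //; exact: (@borel_bigsetU _ predT).
have tE : trivIset setT E := trivIset_seqDU F.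
have sumE : \sum_(i < size s) mu (E i) = 1.
  rewrite -(@mu_bigsetU _ predT) // -bigsetU_seqDU -(muT hmu); congr (mu _).
  apply/seteqP; split=> // y _; have [x /= xs [w Ww <-]] := sW y I.
  rewrite -bigcup_mkord; exists (index x s) => /=; first by rewrite index_mem.
  by rewrite /F index_mem xs nth_index //; exists w.
have cle : c <= \sum_(i < size s) mu (E i) * mu (D `&` [set nth 0 s i + a | a in A]).
  rewrite -[c]mul1r -sumE mulr_suml; apply: ler_sum => i _.
  by apply: ler_wpM2l; [exact: (mu_ge0 hmu)|exact: hc].
apply: (le_trans cle); apply: (@le_trans _ _ (mu U * mu D)).
  apply: (@sum_mu_setI_le _ _ _ (fun i : 'I_(size s) => [set nth 0 s i + a | a in A])) => //.
    by move=> i; exact: (bK (compact_translate _ cA)).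
  move=> y Dy.
  rewrite -(mu_translate hmu y (borel_open oU)).
  under eq_bigr do rewrite mulr_natr mulrb.
  rewrite -big_mkcond /= -(@mu_bigsetU _ (fun i => y \in [set nth 0 s i + a | a in A])) //.
  apply: (mu_mono hmu); first exact: (@borel_bigsetU _ (fun i => y \in [set nth 0 s i + a | a in A])).
    by apply: borel_open; exact: open_translate_image.
  rewrite -bigcup_seq_cond => z [i /= /andP[_ /set_mem [a Aa <-]] [+ _]].
  rewrite /F ltn_ord => -[w Ww <-].
  exists (- a + w); last by rewrite addrA addrK.
  by apply: NW; exists (- a); [exists a|exists w].
have := mu_le1 hmu bD; have := mu_ge0 hmu bD; nra.
Qed.

(** Averaging with [D] the whole group gives [mu A <= mu (- A)]; applied to [- A] it gives the
    converse. *)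
Lemma mu_opp A : compact A -> mu [set - a | a in A] = mu A.
Proof.
have le B : compact B -> mu B <= mu [set - a | a in B].
  move=> cB; rewrite -[leRHS]mul1r -(muT hmu); apply: average_translate => //.
    exact: borelT.
  by move=> x; rewrite setTI (mu_translate hmu) //; exact: (bK cB).
move=> cA; apply/le_anti/andP; split; last exact: le.
apply: le_trans (le _ (compact_opp cA)) _.
suff -> : [set - a | a in [set - a | a in A]] = A by [].
apply/seteqP; split=> [_ [_ [a Aa <-] <-]|a Aa]; first by rewrite opprK.
by exists (- a); [exists a|rewrite opprK].
Qed.

(** By averaging with [D = A] and [mu_opp], a lower bound valid for all translates cannot exceed
    [mu A * mu A]. *)
Lemma exists_translate_lt A c : compact A -> mu A * mu A < c ->
  exists x, mu (A `&` [set x + a | a in A]) < c.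
Proof.
move=> cA; rewrite ltNge -{2}(mu_opp cA) => h; apply: contrapT => hx.
move/negP: h; apply; apply: average_translate => //; first exact: (bK cA).
by move=> x; rewrite leNgt; apply/negP => ?; apply: hx; exists x.
Qed.

(* [A] meets [x - B], as the two measures add up to more than 1. *)
Lemma sumset_full A B : compact A -> compact B -> 1 < mu A + mu B -> sumset A B = setT.
Proof.
move=> cA cB AB; apply/seteqP; split=> // x _.
have cN := compact_translate x (compact_opp cB).
have bA := borel_compact hT cA; have bN := borel_compact hT cN.
have [[a [Aa [_ [b Bb <-] ab]]]|/set0P/negP/negPn/eqP A0] :=
    pselect ((A `&` [set x + b | b in [set - b | b in B]]) !=set0).
  by exists a => //; exists b => //; rewrite -ab subrK.
have := mu_modular hmu bA bN; rewrite A0 (mu0 hmu) (mu_translate hmu) ?mu_opp //; last first.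
  exact: (bK (compact_opp cB)).
have := mu_le1 hmu (borelU bA bN); lra.
Qed.

(** For [y] near [x] both translates lie in [x + U], with [U] open of measure below [mu A + e]. So
    their union exceeds each of them by less than [e]. *)
Lemma continuous_mu_translate A : compact A ->
  continuous (fun x => mu (A `&` [set x + a | a in A])).
Proof.
move=> cA x; have bt y : borel_set [set y + a | a in A].
  exact: (bK (compact_translate y cA)).
have bA := borel_compact hT cA.
apply/cvgrPdist_lt => e e0.
have [U [oU AU Ue]] : exists U, [/\ open U, A `<=` U & mu U < mu A + e].
  by apply: (outer_lt_open hmu); rewrite (mu_outer hmu bA) ltrDl.
have [W [oW W0 AW]] := compact_tube cA oU AU.
have : nbhs x [set y | W (- x + y)].
  apply: open_nbhs_nbhs; split; first exact: open_translate.
  by rewrite /= addNr.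
apply: filterS => y /= Wy.
have bxU : borel_set [set x + a | a in U] by apply: borel_open; exact: open_translate_image.
have hU : mu ([set x + a | a in A] `|` [set y + a | a in A]) < mu A + e.
  apply: le_lt_trans Ue; rewrite -(mu_translate hmu x (borel_open oU)).
  apply: (mu_mono hmu) => //; first exact: borelU.
  move=> _ [] [a Aa <-]; first by exists a => //; exact: AU.
  exists (a + (- x + y)); last by rewrite addrCA addNKr addrC.
  by apply: AW; exists a => //; exists (- x + y).
have h (X Y : set G) : borel_set X -> borel_set Y ->
    mu (A `&` X) <= mu (A `&` Y) + (mu (X `|` Y) - mu Y).
  move=> bX bY; rewrite -mu_setD //.
  apply: le_trans (mu_subadditive (borelI bA bY) (borelD bX bY)).
  apply: (mu_mono hmu); [exact: borelI|by apply: borelU; [exact: borelI|exact: borelD]|].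
  by move=> z [Az Xz]; have [Yz|Yz] := pselect (Y z); [left|right].
have := h _ _ (bt x) (bt y); have := h _ _ (bt y) (bt x).
rewrite [X in mu X - _]setUC !(mu_translate hmu) // ltr_norml; lra.
Qed.

(** Intermediate values on a connected group: the function equals [mu A] at 0 and drops below [c]
    somewhere. *)
Lemma exists_translate_eq A c : connected [set: G] -> compact A ->
  mu A * mu A < c -> c <= mu A -> exists x, mu (A `&` [set x + a | a in A]) = c.
Proof.
move=> conT cA Ac cA'.
have [x xc] := exists_translate_lt cA Ac.
pose f x := mu (A `&` [set x + a | a in A]).
have /connected_intervalP : connected (f @` setT).
  apply: connected_continuous_connected => //.
  by apply: continuous_subspaceT; exact: continuous_mu_translate.
move=> /(_ (f x) (f 0)) h.
have [|||y _ <-] := h _ _ c; last by exists y.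
- by exists x.
- by exists 0.
rewrite (ltW xc) /f (_ : [set 0 + a | a in A] = A) ?setIid //.
by apply/seteqP; split=> [_ [a Aa <-]|a Aa]; [rewrite add0r|exists a => //; rewrite add0r].
Qed.

End Averaging.

Arguments compact_translate {G} x {A}.

(** * Kneser's inequality in connected groups *)

(* Perturbing by the strictly concave sequence [- eta k^2] forbids interior
   near-minimizers, so infima need neither be attained nor be compared level by level. *)
Lemma concave_min_principle (R : realType) (P : nat -> R -> Prop) (N : nat) (m L : R) :
  (forall k v, (k <= N)%N -> P k v -> L <= v) ->
  (forall v, P 0 v -> m <= v) -> (forall v, P N v -> m <= v) ->
  (forall k v, (k.+1 < N)%N -> P k.+1 v ->
    exists v1 v2, [/\ P k v1, P k.+2 v2 & v1 + v2 <= 2 * v]) ->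
  forall k v, (k <= N)%N -> P k v -> m <= v.
Proof.
move=> hL h0 hN step k v kN Pkv; apply/ler_addgt0Pr => e e0.
pose n2 : R := N%:R ^+ 2; have n20 : 0 <= n2 by exact: sqr_ge0.
(* The budget [e] pays [eta * N^2] for the perturbation and [eta] for choosing a near-minimizer. *)
pose eta := e / (n2 + 1); have eta0 : 0 < eta by rewrite divr_gt0 // ltr_wpDl.
have etaE : eta * (n2 + 1) = e by rewrite divfK // gt_eqF // ltr_wpDl.
pose S := [set x | exists j w, [/\ (j <= N)%N, P j w & x = w - eta * j%:R ^+ 2]].
have jn2 j : (j <= N)%N -> 0 <= (j%:R ^+ 2 : R) <= n2.
  by move=> jN; rewrite sqr_ge0 /= lerXn2r ?nnegrE // ler_nat.
have Sinf : has_inf S.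
  split; first by exists (v - eta * k%:R ^+ 2), k, v.
  exists (L - eta * n2) => _ [j [w [jN Pw ->]]].
  by have := hL _ _ jN Pw; have /andP[_] := jn2 _ jN; nra.
have Slb j w : (j <= N)%N -> P j w -> inf S <= w - eta * j%:R ^+ 2.
  by move=> jN Pw; apply: ge_inf; [exact: Sinf.2|exists j, w].
have [_ [j [w [jN Pw ->]]] jw] := inf_adherent eta0 Sinf.
have mI : m - eta * n2 <= inf S + eta.
  have /andP[j0 jn] := jn2 _ jN.
  case: j jN Pw jw j0 jn => [|j] jN Pw jw j0 jn; first by have := h0 _ Pw; nra.
  move: jN; rewrite leq_eqVlt => /orP [/eqP jN|jN].
    by move: Pw; rewrite jN => /hN; nra.
  (* Since [j^2 + (j+2)^2 = 2 (j+1)^2 + 2], the perturbed values at the two neighbours average at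
     least [eta] below the one at [j+1], hence strictly below [inf S]. *)
  have [v1 [v2 [P1 P2 v12]]] := step _ _ jN Pw.
  have := Slb _ _ (ltnW (ltnW jN)) P1; have := Slb _ _ jN P2.
  have -> : (j.+2%:R : R) = j%:R + 2 by rewrite -addn2 natrD.
  move: jw; have -> : (j.+1%:R : R) = j%:R + 1 by rewrite -addn1 natrD.
  by move=> jw s1 s2; exfalso; nra.
have := Slb _ _ kN Pkv; have /andP[k0 _] := jn2 _ kN; nra.
Qed.

Section Kneser.
Variables (R : realType) (G : topologicalZmodType) (mu : set G -> R).
Hypotheses (hT : hausdorff_space G) (cT : compact [set: G]) (conT : connected [set: G]).
Hypothesis hmu : haar_probability mu.
Implicit Types (A B : set G).

Let bK A (cA : compact A) : borel_set A := borel_compact hT cA.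

Lemma mu_le_sumset A B : compact A -> compact B -> B !=set0 -> mu A <= mu (sumset A B).
Proof.
move=> cA cB [b Bb]; rewrite -(mu_translate hmu b (bK cA)) translateE.
apply: (mu_mono hmu).
- exact: (bK (compact_sumset cA (@compact_set1 _ b))).
- exact: (bK (compact_sumset cA cB)).
- by apply: sumsetS => // _ ->.
Qed.

(** [(A]&[A') + B] lies in both [A + B] and [A' + B], and sumsets commute with unions; modularity of
    [mu] does the rest. *)
Lemma excess_submodular A A' B : compact A -> compact A' -> compact B ->
  mu (sumset (A `|` A') B) + mu (sumset (A `&` A') B) <=
  mu (sumset A B) + mu (sumset A' B).
Proof.
move=> cA cA' cB; have bAB := bK (compact_sumset cA cB).
have bAB' := bK (compact_sumset cA' cB).
rewrite -(mu_modular hmu bAB bAB') sumsetUl lerD2l; apply: (mu_mono hmu).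
- by apply: bK; apply: compact_sumset => //; apply: compact_closedI => //; exact: compact_closed.
- exact: borelI.
- by move=> _ [a [? ?] [b ? <-]]; split; exists a => //; exists b.
Qed.

(** Take the intersection and the union of [A] with a translate [x + A], where [x] makes the
    intersection have measure [mu A - d]; [x + A] has the same excess as [A]. *)
Lemma excess_step A B d : compact A -> compact B -> 0 <= d -> mu A * mu A < mu A - d ->
  exists A1 A2, [/\ compact A1, compact A2, mu A1 = mu A - d, mu A2 = mu A + d &
    mu (sumset A1 B) + mu (sumset A2 B) <= 2 * mu (sumset A B)].
Proof.
move=> cA cB d0 Ad; have cAd : mu A - d <= mu A by lra.
have [x xd] := exists_translate_eq hT cT hmu conT cA Ad cAd.
have cx := compact_translate x cA.
exists (A `&` [set x + a | a in A]), (A `|` [set x + a | a in A]); split=> //.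
- by apply: compact_closedI => //; exact: compact_closed.
- exact: compactU.
- have := mu_modular hmu (bK cA) (bK cx); rewrite xd (mu_translate hmu _ (bK cA)); lra.
- have := excess_submodular cA cx cB.
  have -> : mu (sumset [set x + a | a in A] B) = mu (sumset A B).
    rewrite translateE -sumsetA (sumsetC [set x]) sumsetA -translateE.
    exact: (mu_translate hmu x (bK (compact_sumset cA cB))).
  lra.
Qed.

(** The concavity principle is applied to the excesses of sets whose measures run over an arithmetic
    progression through [mu A]; [u] bounds the error at its two ends. *)
Lemma kneser_approx A B (u : R) (M : nat) : compact A -> compact B ->
  0 < mu A -> mu A + mu B <= 1 -> (0 < M)%N -> u * M%:R = 1 -> u <= mu B ->
  mu B - u <= mu (sumset A B) - mu A.
Proof.
move=> cA cB A0 AB1 M0 uM uB; set t := mu A in A0 AB1 *; set b := mu B in AB1 uB *.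
have M1 : 1 <= M%:R :> R by rewrite ler1n.
have b0 : 0 <= b by exact: (mu_ge0 hmu (bK cB)).
have u0 : 0 < u by nra.
have u1 : u <= 1 by nra.
have tu : t * u <= u by nra.
(* The step [t u^2] is small enough for [excess_step] at every interior level, and [u M = 1] puts
   [t] itself at index [M^2 - M]. *)
pose a k : R := t * u + k%:R * (t * u * u).
have d0 : 0 < t * u * u by rewrite !mulr_gt0.
have exN : exists N, 1 - b < a N.
  have [k hk] : exists k, (t * u * u)^-1 < k%:R.
    by exists (Num.truncn (t * u * u)^-1).+1; exact: truncnS_gt.
  exists k; have : 1 < k%:R * (t * u * u) by rewrite -ltr_pdivrMr // mul1r.
  have : 0 < t * u by exact: mulr_gt0.
  by rewrite /a; lra.
have [N hN minN] := ex_minnP exN.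
have aS k : a k.+1 = a k + t * u * u by rewrite /a -natr1; ring.
have kN k : (k < N)%N -> a k <= 1 - b.
  by move=> kN; rewrite leNgt; apply/negP => /minN; rewrite leqNgt kN.
have aM : a (M * M - M)%N = t.
  rewrite /a natrB ?leq_pmulr // natrM.
  transitivity (t * u + t * ((u * M%:R) * (u * M%:R)) - t * u * (u * M%:R)); first by ring.
  by rewrite uM; ring.
pose P k v := exists A, [/\ compact A, mu A = a k & v = mu (sumset A B) - mu A].
apply: (@concave_min_principle _ P N _ (- 1) _ _ _ _ (M * M - M)%N).
- move=> k _ _ [D [cD _ ->]]; have := mu_le1 hmu (bK cD).
  have := mu_ge0 hmu (bK (compact_sumset cD cB)); lra.
(* Bottom level: [D + B] has measure at least [mu B], while [D] has measure only [t u <= u]. *)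
- move=> _ [D [cD Da ->]]; rewrite /a mul0r addr0 in Da; rewrite Da.
  have [D0|/set0P D0] := eqVneq D set0.
    have : 0 < t * u by exact: mulr_gt0.
    by move: Da; rewrite D0 (mu0 hmu); lra.
  by have := mu_le_sumset cB cD D0; rewrite sumsetC -/b; lra.
(* Top level: [D + B] is the whole group, and [a N] overshoots [1 - b] by at most one step, as [N]
   is minimal. *)
- move=> _ [D [cD Da ->]]; rewrite (sumset_full hT cT hmu) ?Da //; last by rewrite -/b; lra.
  rewrite (muT hmu).
  have : a N <= 1 - b + t * u * u.
    case: {hN minN Da} N kN => [|N] kN; last by rewrite aS lerD2r; exact: kN.
    by rewrite /a; nra.
  nra.
- move=> k _ kkN [D [cD Da ->]].
  (* With [x = a k.+1], one has [x <= 1 - b <= 1 - u] and [x > t u], so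
     [x (1 - x) >= x u > t u^2]. *)
  have [|D1 [D2 [c1 c2 m1 m2 h]]] := @excess_step D B (t * u * u) cD cB (ltW d0).
    have := kN _ kkN; rewrite Da.
    have : t * u + t * u * u <= a k.+1.
      by rewrite /a lerD2l -{1}[t * u * u]mul1r ler_pM2r // ler1n.
    move=> lo hi; have a0 : 0 <= a k.+1 by apply: le_trans lo; rewrite addr_ge0 // ltW // mulr_gt0.
    have h1 : 0 <= a k.+1 * (1 - a k.+1 - u) by rewrite mulr_ge0 //; lra.
    have h2 : 0 <= (a k.+1 - (t * u + t * u * u)) * u by rewrite mulr_ge0 ?(ltW u0) // subr_ge0.
    have h3 : 0 < t * u * u * u by rewrite mulr_gt0.
    by lra.
  exists (mu (sumset D1 B) - mu D1), (mu (sumset D2 B) - mu D2); split.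
  + by exists D1; split=> //; rewrite m1 Da aS addrK.
  + by exists D2; split=> //; rewrite m2 Da -aS.
  + by rewrite m1 m2; lra.
- rewrite leqNgt; apply/negP => /ltnW NM.
  have : a N <= t by rewrite -aM /a lerD2l ler_pM2r // ler_nat.
  lra.
- by exists A; rewrite aM.
Qed.

(** Null sets are settled by monotonicity under translation; otherwise let [u = 1 / (k + 1)] tend to
    0 in [kneser_approx]. *)
Theorem kneser_connected A B : compact A -> compact B -> A !=set0 -> B !=set0 ->
  mu A + mu B <= 1 -> mu A + mu B <= mu (sumset A B).
Proof.
move=> cA cB A0 B0 AB1.
have [Az|Ap] := lerP (mu A) 0.
  have := mu_le_sumset cB cA A0; rewrite sumsetC; lra.
have [Bz|Bp] := lerP (mu B) 0.
  have := mu_le_sumset cA cB B0; lra.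
apply/ler_addgt0Pr => e e0.
have m0 : 0 < Num.min e (mu B) by rewrite lt_min e0.
have [k] := ltr_add_invr m0; rewrite add0r lt_min => /andP[ke kB].
have uM : k.+1%:R^-1 * k.+1%:R = 1 :> R by rewrite mulVf ?pnatr_eq0.
move: (kneser_approx cA cB Ap AB1 (ltn0Sn k) uM (ltW kB)) ke.
by move: (k.+1%:R^-1) => u ? ?; lra.
Qed.

End Kneser.

(** * Pluennecke's inequality *)

Section Plunnecke.
Variables (R : realType) (G : topologicalZmodType) (mu : set G -> R).
Hypotheses (hT : hausdorff_space G) (cT : compact [set: G]).
Hypothesis hmu : haar_probability mu.
Implicit Types (A B X Z U : set G) (s : seq G) (n : nat).

Let bK A (cA : compact A) : borel_set A := borel_compact hT cA.

Let setU_cons c s : [set` c :: s] = [set c] `|` [set` s].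
Proof.
apply/seteqP; split=> x /=; first by rewrite inE => /orP [/eqP ->|]; [left|right].
by move=> [->|xs]; rewrite inE ?eqxx ?xs ?orbT.
Qed.

Lemma compact_seq s : compact [set` s].
Proof.
elim: s => [|c s IH]; first by rewrite set_nil; exact: compact0.
by rewrite setU_cons; apply: compactU => //; exact: compact_set1.
Qed.

(** Translates [c + X] are added one at a time. By submodularity the overlap with the earlier ones
    may be subtracted; moved back by [- c] it is a subset of [X], so the minimality hypothesis
    bounds its sumset from below. Each translate costs one error [e]. *)
Lemma petridis X U (K e : R) : compact X -> open U ->
  (forall Z, compact Z -> Z `<=` X -> K * mu Z <= mu (sumset Z U)) ->
  mu (sumset X U) <= K * mu X + e ->
  forall s, mu (sumset (sumset X [set` s]) U) <=
            K * mu (sumset X [set` s]) + (size s)%:R * e.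
Proof.
move=> cX oU hZ hX; elim=> [|c s IH].
  have X0 : sumset X [set` [::]] = set0 by rewrite set_nil; apply/seteqP; split=> // _ [? _ [? []]].
  have U0 : sumset set0 U = set0 by apply/seteqP; split=> // _ [? []].
  by rewrite X0 U0 (mu0 hmu) mulr0 mul0r addr0.
have bU Z : borel_set (sumset Z U) by apply: borel_open; exact: open_sumset.
rewrite setU_cons sumsetUr sumsetUl.
set P := sumset X [set` s] in IH *; set Q := sumset X [set c].
have cP : compact P by apply: compact_sumset => //; exact: compact_seq.
have cQ : compact Q by apply: compact_sumset => //; exact: compact_set1.
have QE : Q = [set c + x | x in X] by rewrite translateE.
have translateU Z : mu (sumset [set c + x | x in Z] U) = mu (sumset Z U).
  by rewrite translateE -sumsetA (sumsetC [set c]) sumsetA -translateE (mu_translate hmu).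
have cQP : compact (Q `&` P) by apply: compact_closedI => //; exact: compact_closed.
have hQP : K * mu (Q `&` P) <= mu (sumset (Q `&` P) U).
  have cZ := compact_translate (- c) cQP.
  have ZX : [set - c + x | x in Q `&` P] `<=` X.
    by rewrite QE => _ [_ [[x Xx <-] _] <-]; rewrite addKr.
  have ZE : [set c + x | x in [set - c + x | x in Q `&` P]] = Q `&` P.
    apply/seteqP; split=> [_ [_ [x Qx <-] <-]|x Qx]; first by rewrite addNKr.
    by exists (- c + x); [exists x|rewrite addNKr].
  have := hZ _ cZ ZX; rewrite -(translateU [set - c + x | x in Q `&` P]) ZE.
  by rewrite (mu_translate hmu (- c) (bK cQP)).
have sub : mu (sumset (Q `&` P) U) <= mu (sumset Q U `&` sumset P U).
  apply: (mu_mono hmu) => //; first exact: borelI.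
  by move=> _ [x [Qx Px] [u Uu <-]]; split; exists x => //; exists u.
have mQU : mu (sumset Q U) <= K * mu Q + e.
  by rewrite QE translateU (mu_translate hmu c (bK cX)).
have m1 := mu_modular hmu (bU Q) (bU P).
have /(congr1 (fun x => K * x)) := mu_modular hmu (bK cQ) (bK cP).
rewrite !mulrDr /= => m2; rewrite -natr1 mulrDl mul1r; lra.
Qed.

(* [B] is first thickened to the open set [V = B + W], so that each [k B] is covered
   by [C k + W] with [C k] finite; the sets [C k] are fixed before the near-minimizer
   [X] of [mu (X + V) / mu X], hence the errors [size (C k) * e] can be absorbed. *)
Lemma plunnecke A B (alpha : R) n : compact A -> compact B -> B !=set0 ->
  mu (sumset A B) < alpha * mu A ->
  exists X, [/\ compact X, X `<=` A, 0 < mu X &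
    mu (sumset X (nfold_sumset n B)) <= alpha ^+ n * mu X].
Proof.
move=> cA cB B0 AB; have bAB := bK (compact_sumset cA cB).
have mA : 0 < mu A.
  rewrite lt_neqAle (mu_ge0 hmu (bK cA)) andbT eq_sym; apply/negP => /eqP A0.
  by move: AB; rewrite A0 mulr0 ltNge (mu_ge0 hmu bAB).
have alpha1 : 1 <= alpha by have := mu_le_sumset hT hmu cA cB B0; nra.
have [U [oU ABU Ua]] : exists U, [/\ open U, sumset A B `<=` U & mu U < alpha * mu A].
  by apply: (outer_lt_open hmu); rewrite (mu_outer hmu).
have [W [oW W0 ABW]] := compact_tube (compact_sumset cA cB) oU ABU.
pose V := sumset B W; have oV : open V by exact: open_sumset.
have bV Z : borel_set (sumset Z V) by apply: borel_open; exact: open_sumset.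
have AV : mu (sumset A V) < alpha * mu A.
  by apply: le_lt_trans Ua; apply: (mu_mono hmu) => //; [exact: borel_open|rewrite sumsetA].
have /choice[C hC] k := compact_net (@compact_nfold _ k _ cB) oW W0.
pose S := [set mu (sumset X V) / mu X | X in [set X | [/\ compact X, X `<=` A & 0 < mu X]]].
have Sinf : has_inf S.
  split; first by exists (mu (sumset A V) / mu A), A => //; split=> //; exact: subset_refl.
  by exists 0 => _ [X [_ _ X0] <-]; rewrite divr_ge0 ?(ltW X0) // (mu_ge0 hmu).
pose K := inf S.
have KX X : compact X -> X `<=` A -> 0 < mu X -> K * mu X <= mu (sumset X V).
  move=> cX XA X0; rewrite -ler_pdivlMr //; apply: ge_inf; first exact: Sinf.2.
  by exists X.
have K0 : 0 <= K.
  apply: lb_le_inf; first exact: Sinf.1.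
  by move=> _ [X [_ _ X0] <-]; rewrite divr_ge0 ?(ltW X0) // (mu_ge0 hmu).
have Ka : K < alpha by have := KX A cA (fun _ => id) mA; nra.
pose N := (\max_(k < n) size (C k))%N.
(* Then [size (C k) * e <= alpha - K] for every [k < n]: the gap between [K] and [alpha] absorbs all
   errors. *)
pose e := (alpha - K) / (N%:R + 1).
have N0 : 0 < N%:R + 1 :> R by rewrite ltr_wpDl.
have e0 : 0 < e by rewrite divr_gt0 // subr_gt0.
have eN : e * (N%:R + 1) = alpha - K by rewrite divfK // gt_eqF.
have [_ [X [cX XA X0] <-]] := inf_adherent e0 Sinf.
rewrite -/K ltr_pdivrMr // => XV; exists X; split=> //.
have hZ Z : compact Z -> Z `<=` X -> K * mu Z <= mu (sumset Z V).
  move=> cZ ZX; have [Z0|Z0] := ltrP 0 (mu Z).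
    by apply: KX => //; exact: subset_trans XA.
  by apply: le_trans (mu_ge0 hmu (bV Z)); rewrite mulr_ge0_le0.
have XVe : mu (sumset X V) <= K * mu X + e * mu X by rewrite -mulrDl ltW.
have step := petridis cX oV hZ XVe.
suff : forall k, (k <= n)%N -> mu (sumset X (nfold_sumset k B)) <= alpha ^+ k * mu X by apply.
elim=> [_|k IH kn]; first by rewrite nfold_sumset0 sumsetC sumset0l expr0 mul1r.
have {}IH := IH (ltnW kn); have [Ck kC] := hC k.
have cXk : compact (sumset X (nfold_sumset k B)).
  by apply: compact_sumset => //; exact: compact_nfold.
(* As [k B] lies in [C k + W], the set [X + (k+1) B] lies in [(X + C k) + V], to which [petridis]
   applies. *)
have h1 : mu (sumset X (nfold_sumset k.+1 B)) <= mu (sumset (sumset X [set` C k]) V).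
  apply: (mu_mono hmu) => //.
    by apply: bK; apply: compact_sumset => //; exact: compact_nfold.
  rewrite -sumsetA; apply: sumsetS => //; rewrite nfold_sumsetS /V (sumsetC B) sumsetA.
  exact: sumsetS.
have h2 : mu (sumset X [set` C k]) <= mu (sumset X (nfold_sumset k B)).
  apply: (mu_mono hmu); [|exact: (bK cXk)|exact: sumsetS].
  by apply: bK; apply: compact_sumset => //; exact: compact_seq.
have h3 : (size (C k))%:R * (e * mu X) <= (alpha - K) * mu X.
  have : (size (C k))%:R <= N%:R :> R.
    by rewrite ler_nat; exact: (@leq_bigmax _ (fun i : 'I_n => size (C i)) (Ordinal kn)).
  rewrite -eN mulrA => sN; rewrite ler_pM2r // mulrC ler_pM2l //; lra.
have h4 := step (C k).
have ak : 1 <= alpha ^+ k by rewrite exprn_ege1.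
have h5 : K * mu (sumset X [set` C k]) <= K * (alpha ^+ k * mu X).
  by apply: ler_wpM2l => //; exact: le_trans IH.
have h6 : 0 <= (alpha - K) * (alpha ^+ k - 1) * mu X.
  by rewrite !mulr_ge0 // ?(ltW X0) // subr_ge0 // ltW.
rewrite exprS; lra.
Qed.

Lemma compact_nfold_bound A B (alpha : R) n : connected [set: G] ->
  compact A -> compact B -> B !=set0 ->
  mu (sumset A B) < alpha * mu A -> alpha ^+ n * mu A < 1 ->
  mu (nfold_sumset n B) <= (alpha ^+ n - 1) * mu A.
Proof.
move=> conT cA cB B0 AB An; have [X [cX XA X0 Xn]] := plunnecke n cA cB B0 AB.
have mXA : mu X <= mu A by apply: (mu_mono hmu) => //; exact: bK.
have alpha1 : 1 <= alpha by have := mu_le_sumset hT hmu cA cB B0; nra.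
have an : 1 <= alpha ^+ n by rewrite exprn_ege1.
have cN := @compact_nfold _ n _ cB.
have hA : (alpha ^+ n - 1) * mu X <= (alpha ^+ n - 1) * mu A.
  by apply: ler_wpM2l => //; rewrite subr_ge0.
have Xlt : alpha ^+ n * mu X < 1.
  by apply: le_lt_trans An; apply: ler_wpM2l => //; exact: le_trans an.
(* If the measures added up to more than 1, [X + nB] would be the whole group, against
   [alpha ^+ n * mu X < 1]. *)
have [XN|XN] := lerP (mu X + mu (nfold_sumset n B)) 1; last first.
  by move: Xn; rewrite (sumset_full hT cT hmu cX cN XN) (muT hmu); lra.
have XN0 : X !=set0.
  by apply/set0P/negP => /eqP XE; move: X0; rewrite XE (mu0 hmu) ltxx.
have BN0 : nfold_sumset n B !=set0.
  by case: B0 => b Bb; exists (\sum_(i < n) b); exists (fun=> b).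
have := kneser_connected hT cT conT hmu cX cN XN0 BN0 XN; lra.
Qed.

End Plunnecke.

(** * Capacitability of K-analytic sets *)

(** Each point outside [O] has a neighbourhood missing some [Q i], hence all later ones; compactness
    makes the index uniform. *)
Lemma compact_bigcap_open (Y : topologicalType) (Q : nat -> set Y) (O : set Y) :
  compact [set: Y] -> (forall i, closed (Q i)) -> nonincreasing_seq Q ->
  open O -> \bigcap_i Q i `<=` O -> exists i, Q i `<=` O.
Proof.
move=> /compact_near_coveringP cY cQ niQ oO QO.
have : \forall i \near \oo, [set: Y] `<=` (fun y => Q i y -> O y).
  apply: (cY _ \oo (fun i y => Q i y -> O y)) => y _.
  have [Oy|nOy] := pselect (O y).
    exists (O, setT) => /=; first by split; [exact: open_nbhs_nbhs|exact: filterT].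
    by move=> [z i] [/= Oz _] _.
  have [i nQ] : exists i, ~ Q i y.
    by apply: contrapT => h; apply: nOy; apply: QO => i _; apply: contrapT => ?; apply: h; exists i.
  exists (~` Q i, [set j | (i <= j)%N]) => /=.
    split; last exact: nbhs_infty_ge.
    by apply: open_nbhs_nbhs; split=> //; exact: closed_openC.
  move=> [z j] [/= nQz ij] Qz; exfalso; apply: nQz.
  by have := niQ _ _ ij; rewrite subsetEset; apply.
by move=> [i _ h]; exists i => y; exact: (h i (leqnn i) y I).
Qed.

Section Capacitability.
Variables (R : realType) (G : topologicalZmodType) (mu : set G -> R).
Hypothesis hmu : haar_probability mu.

Lemma capacity_bigcup_lt (F : nat -> set G) n v : nondecreasing_seq F ->
  v < outer_mu mu (nfold_sumset n (\bigcup_j F j)) ->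
  exists j, v < outer_mu mu (nfold_sumset n (F j)).
Proof.
move=> ndF vF; apply: contrapT => h; move: vF; rewrite ltNge => /negP; apply.
apply: le_trans (outer_mono hmu (nfold_bigcup ndF)) _.
apply: (outer_bigcup_le hmu).
  move=> i j ij; rewrite subsetEset; apply: subset_nfold_sumset.
  by rewrite -subsetEset; exact: ndF.
by move=> j; rewrite leNgt; apply/negP => ?; apply: h; exists j.
Qed.

(* Choquet's capacitability argument for the capacity [E |-> mu^* (n E)]. *)
Lemma K_analytic_inner_compact (A : set G) n v : K_analytic A ->
  v < outer_mu mu (nfold_sumset n A) ->
  exists L, [/\ compact L, L `<=` A & v <= outer_mu mu (nfold_sumset n L)].
Proof.
move=> [Y [S [f [hY cY [K [cK SE]] cf ->]]]] vA.
(* Finite unions make the compact sets increasing in [j], as continuity from below requires. *)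
pose K' i j := \big[setU/set0]_(l < j.+1) K i l.
have cK' i j : compact (K' i j) by apply: bigsetU_compact => l _; exact: cK.
have ndK' i : nondecreasing_seq (K' i).
  move=> j k jk; rewrite subsetEset /K' -!bigcup_mkord => y [l /= lj Ky].
  by exists l => //=; exact: leq_trans lj _.
pose big T := T `<=` S /\ v < outer_mu mu (nfold_sumset n (f @` T)).
(* If [T] is big, some cut [T]&[K' i j] stays big, by continuity from below; for other [T] the index
   0 is a dummy value. *)
have /choice[J hJ] (iT : nat * set Y) : exists j, big iT.2 -> big (iT.2 `&` K' iT.1 j).
  case: iT => i T /=; have [[TS vT]|nT] := pselect (big T); last by exists 0%N.
  have [||j vj] := @capacity_bigcup_lt (fun j => f @` (T `&` K' i j)) n v.
  - move=> j k jk; rewrite subsetEset; apply: image_subset; apply: setIS.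
    by rewrite -subsetEset; exact: ndK'.
  - rewrite -image_bigcup -setI_bigcupr (setIidl _) // => y /TS.
    rewrite SE => /(_ i I) [l _ Ky]; exists l => //.
    by rewrite /K' -bigcup_mkord; exists l => //=.
  - by exists j => _; split=> // y [/TS].
pose T := fix T i := if i is i'.+1 then T i' `&` K' i' (J (i', T i')) else S.
have bT i : big (T i).
  by elim: i => [|i IH] /=; [split|exact: (hJ (i, T i))].
(* The cuts [T i] need not be closed, but the [Q i] enclosing them are, and the intersection of all
   [Q i] lies in [S]. *)
pose Q i := \bigcap_(l < i) K' l (J (l, T l)).
have TQ i : T i `<=` Q i.
  elim: i => [|i IH] y; first by move=> _ l.
  move=> /= [/IH Qy Ky] l; rewrite /= ltnS leq_eqVlt => /orP [/eqP -> //|].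
  exact: Qy.
have clK' i j : closed (K' i j) by exact: compact_closed.
have cQ i : closed (Q i) by apply: closed_bigI => l _.
have niQ : nonincreasing_seq Q.
  move=> i j ij; rewrite subsetEset => y Qy l li; apply: Qy; exact: leq_trans li ij.
pose L := \bigcap_i Q i.
have LS : L `<=` S.
  move=> y Ly; rewrite SE => i _; have := Ly i.+1 I i (ltnSn i).
  by rewrite /K' -bigcup_mkord => -[l _ Ky]; exists l.
have cL : compact L.
  by apply: subclosed_compact cY _ => //; exact: closed_bigI.
have cfL : compact (f @` L).
  by apply: continuous_compact => //; exact: continuous_subspaceW cf.
exists (f @` L); split=> //; first exact: image_subset.
apply: (le_outer hmu) => U oU LU.
(* An open set around [n f(L)] already contains [n f(T i)] for some [i]: pull [V] back to the trace
   on [S] of an open [D], which must contain some [Q i]. *)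
have [V [oV LV VU]] := nfold_tube cfL oU LU.
have oSV : open (f @^-1` V : set (subspace S)) by move/continuousP: cf; apply.
have [D oD DV] := (open_subspaceP _ _).1 oSV.
have LD : L `<=` D.
  move=> y Ly; have : (f @^-1` V `&` S) y by split; [apply: LV; exists y|exact: LS].
  by rewrite -DV => -[].
have [i QD] := compact_bigcap_open cY cQ niQ oD LD.
have [TS vT] := bT i; apply: ltW; apply: lt_le_trans vT _.
apply: (outer_le_open hmu) => //; apply: subset_trans VU.
apply: subset_nfold_sumset => _ [y Ty <-].
have : (D `&` S) y by split; [apply: QD; exact: TQ|exact: TS].
by rewrite DV => -[].
Qed.

End Capacitability.

(** * Passage from compact to K-analytic sets *)

Lemma le_exprn_lim (R : realType) (x y z : R) n : (0 < n)%N ->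
  1 <= x -> 0 < z -> x ^+ n * z < 1 ->
  (forall t, x < t -> t ^+ n * z < 1 -> y <= (t ^+ n - 1) * z) ->
  y <= (x ^+ n - 1) * z.
Proof.
move=> n0 x1 z0 xn h.
have c : ((fun t : R => (t ^+ n - 1) * z) @ x^'+) --> (x ^+ n - 1) * z.
  apply: cvg_at_right_filter; apply: cvgMr_tmp.
  by apply: cvgB; [exact: exprn_continuous|exact: cvg_cst].
apply: (cvgr_to_ge c).
have c' : ((fun t : R => t ^+ n * z) @ x^'+) --> x ^+ n * z.
  by apply: cvg_at_right_filter; apply: cvgMr_tmp; exact: exprn_continuous.
near=> t; apply: h; first by near: t; exact: nbhs_right_gt.
near: t; exact: (cvgr_lt _ c').
Unshelve. all: by end_near. Qed.

Theorem theorem1p4 (R : realType) (G : topologicalZmodType) (mu : set G -> R)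
  (alpha : R) (A B : set G) :
  hausdorff_space G -> compact [set: G] -> connected [set: G] ->
  haar_probability mu ->
  K_analytic A -> K_analytic B ->
  0 < outer_mu mu (sumset A B) ->
  outer_mu mu (sumset A B) <= alpha * outer_mu mu A ->
  forall n : nat, (0 < n)%N -> alpha ^+ n < (outer_mu mu A)^-1 ->
  outer_mu mu (nfold_sumset n B) <= (alpha ^+ n - 1) * outer_mu mu A.
Proof.
move=> hT cT conT hmu kA kB AB0 ABa n n0 an.
have bK K (cK : compact K) : borel_set K := borel_compact hT cK.
set m := outer_mu mu A in ABa an *.
have m0 : 0 < m.
  rewrite lt_neqAle (outer_ge0 hmu) andbT eq_sym; apply/negP => /eqP mE.
  by move: ABa; rewrite mE mulr0 leNgt AB0.
have [b Bb] : B !=set0.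
  apply/set0P/negP => /eqP BE; move: AB0; rewrite BE.
  have -> : sumset A set0 = set0 by apply/seteqP; split=> // _ [? _ [? []]].
  by rewrite (mu_outer hmu (@borel0 G)) (mu0 hmu) ltxx.
have mAB : m <= outer_mu mu (sumset A B).
  apply: (le_outer hmu) => U oU ABU.
  rewrite -(mu_translate hmu (- b) (borel_open oU)); apply: (outer_le_open hmu).
    exact: open_translate_image.
  by move=> a Aa; exists (a + b); [apply: ABU; exists a => //; exists b|rewrite addrC addrK].
have alpha1 : 1 <= alpha by nra.
have an1 : alpha ^+ n * m < 1 by rewrite -ltr_pdivlMr // div1r.
(* Replacing [alpha] by a slightly larger [t] leaves room for the strict inequality required of
   compact subsets. *)
apply: le_exprn_lim => // t at1 tn; rewrite leNgt; apply/negP.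
have t1 : 1 <= t ^+ n by rewrite exprn_ege1 //; lra.
set c := (t ^+ n - 1) * m => cB.
(* Arguing by contradiction, [v] is the midpoint between the claimed bound and the larger
   [mu^*(nB)]; a compact [B'] still reaches it. *)
pose v := (c + outer_mu mu (nfold_sumset n B)) / 2.
have vB : v < outer_mu mu (nfold_sumset n B) by rewrite /v; lra.
have [B' [cB' B'B vB']] := K_analytic_inner_compact hmu kB vB.
(* A compact [A'] of measure at least [w > alpha m / t] gives [mu (A' + B') <= alpha m < t * mu A'].
   It comes from the capacity with [n = 1]. *)
pose w := (alpha / t * m + m) / 2.
have at_lt : alpha / t * m < m by rewrite gtr_pMl // ltr_pdivrMr; lra.
have wA : w < outer_mu mu (nfold_sumset 1 A) by rewrite nfold_sumset1 -/m /w; lra.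
have [A' [cA' A'A wA']] := K_analytic_inner_compact hmu kA wA.
rewrite nfold_sumset1 (mu_outer hmu (bK _ cA')) in wA'.
have c0 : 0 <= c by rewrite mulr_ge0 ?(ltW m0) // subr_ge0.
have cN := @compact_nfold _ n _ cB'.
rewrite (mu_outer hmu (bK _ cN)) in vB'.
have B'0 : B' !=set0.
  apply/set0P/negP => /eqP BE; move: vB'.
  have -> : nfold_sumset n B' = set0.
    by rewrite BE; case: (n) n0 => // k _; rewrite nfold_sumsetS; apply/seteqP; split=> // _ [? _ [? []]].
  by rewrite (mu0 hmu) /v; lra.
have A'm : mu A' <= m by rewrite -(mu_outer hmu (bK _ cA')); exact: (outer_mono hmu).
have AB' : mu (sumset A' B') < t * mu A'.
  apply: (@le_lt_trans _ _ (alpha * m)).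
    rewrite -(mu_outer hmu (bK _ (compact_sumset cA' cB'))); apply: le_trans ABa.
    by apply: (outer_mono hmu); exact: sumsetS.
  have : alpha / t * m < mu A' by move: wA'; rewrite /w; lra.
  have -> : alpha / t * m = (alpha * m) / t by rewrite mulrAC.
  by rewrite ltr_pdivrMr ?(mulrC t) //; lra.
have tA' : t ^+ n * mu A' < 1.
  by apply: le_lt_trans tn; apply: ler_wpM2l => //; lra.
have := compact_nfold_bound hT cT hmu conT cA' cB' B'0 AB' tA'.
have : (t ^+ n - 1) * mu A' <= c by apply: ler_wpM2l; lra.
by move: vB'; rewrite /v; lra.
Qed.
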